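(* For a symmetric matrix $X\in\mathbb{R}^{n\times n}$, the following two constraints are equivalent: (i) $X\succeq0$; (ii) $\langle X,Y\rangle\le\mathrm{tr}(X)$ for all $Y\in S^n_+$ with $\|Y\|_\sigma\le1$.
   Context: $S^n_+$ is the cone of real symmetric positive semidefinite $n\times n$ matrices, $\langle\cdot,\cdot\rangle$ is the Euclidean (trace) inner product, and $\|\cdot\|_\sigma$ is the spectral norm (largest singular value). *)

(* Defs.v *)
From mathcomp Require Export all_boot all_order all_algebra.
From mathcomp Require Export boolp classical_sets reals.

Set Implicit Arguments.
Unset Strict Implicit.
Unset Printing Implicit Defensive.

Import Order.TTheory GRing.Theory Num.Theory.

Local Open Scope classical_set_scope.
Local Open Scope ring_scope.

Definition trace_inner (R : realType) (n : nat) (A B : 'M[R]_n) : R :=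
  \tr (A^T *m B).

(* The cone S^n_+; symmetry is part of positive semidefiniteness. *)
Definition psdmx (R : realType) (n : nat) (A : 'M[R]_n) : Prop :=
  A \is symmetricmx /\ forall x : 'cV[R]_n, 0 <= (x^T *m A *m x) 0 0.

(* [eigenvalue] is about row eigenvectors; as A^T A is symmetric, its row and
   column eigenvectors are transposes of one another. *)
Definition singular_values (R : realType) (n : nat) (A : 'M[R]_n) : set R :=
  [set Num.sqrt a | a in [set a | eigenvalue (A^T *m A) a]].

(* The set of singular values is finite, and nonempty if n > 0, so that [sup]
   is its largest element; for n = 0 the norm is sup set0 = 0. *)
Definition spectral_norm (R : realType) (n : nat) (A : 'M[R]_n) : R :=
  sup (singular_values A).

(* Main.v *)
Require Import Defs.
From mathcomp Require Import ring lra.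

(** If X is positive semidefinite and Y is symmetric of spectral norm at most
    1, then 1 - Y is positive semidefinite too, and tr X - <X, Y> is the trace
    of the product X (1 - Y) of two positive semidefinite matrices, hence
    nonnegative.  Conversely, a vector x <> 0 is tested by letting Y be the
    orthogonal projection 1 - x x^T / |x|^2 onto the hyperplane orthogonal to x:
    its singular values are 0 or 1, and tr X - <X, Y> = x^T X x / |x|^2.

    The first direction rests on two facts that are proved here without
    diagonalising a matrix.

    That the trace is nonnegative ([trace_psd_mul_ge0]) comes from splitting a
    positive semidefinite A into rank one terms z z^T by symmetric Gaussian
    elimination: subtracting c c^T / A_ii, where c is the i-th column, leaves a
    positive semidefinite matrix with one more zero on its diagonal, and a
    positive semidefinite matrix with zero diagonal vanishes.  Each term
    contributes tr (z z^T B) = z^T B z >= 0.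

    That 1 - Y is positive semidefinite ([psd_one_sub]) comes from the
    variational principle ([eigenvalue_max_rayleigh]): the supremum s of the
    Rayleigh quotients x^T Y x / |x|^2 is an eigenvalue of Y.  Compactness of the
    sphere is replaced by [psd_unit_coercive]: were s not an eigenvalue, s - Y
    would be positive semidefinite and invertible, hence bounded below by some
    c > 0, and all the quotients would be at most s - c.  An eigenvalue is at
    most its absolute value, which is a singular value since Y is symmetric.

    Both facts use the Cauchy-Schwarz inequality for a positive semidefinite
    form. *)

Set Implicit Arguments.
Unset Strict Implicit.
Unset Printing Implicit Defensive.

Import Order.TTheory GRing.Theory Num.Theory.

Local Open Scope ring_scope.

(** * Quadratic forms *)

Lemma symmetricmxP (R : realType) (n : nat) (A : 'M[R]_n) :
  reflect (A^T = A) (A \is symmetricmx).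
Proof.
rewrite is_hermitianmxE expr0 scale1r map_mx_id // eq_sym.
exact: eqP.
Qed.

Lemma trmx11E (R : realType) (M : 'M[R]_1) : M 0 0 = M^T 0 0.
Proof. by rewrite mxE. Qed.

Definition bilin (R : realType) (n : nat) (A : 'M[R]_n) (x y : 'cV[R]_n) : R :=
  (x^T *m A *m y) 0 0.

Definition sqnorm (R : realType) (n : nat) (x : 'cV[R]_n) : R := (x^T *m x) 0 0.

Section Bilinear.
Variables (R : realType) (n : nat).
Implicit Types (A B : 'M[R]_n) (x y z : 'cV[R]_n).

Lemma bilinDl A x y z : bilin A (x + y) z = bilin A x z + bilin A y z.
Proof. by rewrite /bilin linearD /= !mulmxDl mxE. Qed.

Lemma bilinDr A x y z : bilin A z (x + y) = bilin A z x + bilin A z y.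
Proof. by rewrite /bilin mulmxDr mxE. Qed.

Lemma bilinZl A a x y : bilin A (a *: x) y = a * bilin A x y.
Proof. by rewrite /bilin linearZ /= -!scalemxAl mxE. Qed.

Lemma bilinZr A a x y : bilin A x (a *: y) = a * bilin A x y.
Proof. by rewrite /bilin -scalemxAr mxE. Qed.

Lemma bilinC A x y : A \is symmetricmx -> bilin A x y = bilin A y x.
Proof.
move/symmetricmxP => Asym.
by rewrite /bilin [LHS]trmx11E !trmx_mul trmxK Asym mulmxA.
Qed.

Lemma bilinB A B x y : bilin (A - B) x y = bilin A x y - bilin B x y.
Proof. by rewrite /bilin mulmxBr mulmxBl !mxE. Qed.

Lemma bilin_scale A a x y : bilin (a *: A) x y = a * bilin A x y.
Proof. by rewrite /bilin -scalemxAr -scalemxAl mxE. Qed.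

Lemma bilin_scalar a x : bilin a%:M x x = a * sqnorm x.
Proof. by rewrite /bilin mul_mx_scalar -scalemxAl mxE. Qed.

Lemma bilin_outer z x y :
  bilin (z *m z^T) x y = (x^T *m z) 0 0 * (y^T *m z) 0 0.
Proof.
rewrite /bilin mulmxA -mulmxA mxE big_ord1.
by congr (_ * _); rewrite [LHS]trmx11E trmx_mul trmxK.
Qed.

Lemma bilin_delta A i j : bilin A (delta_mx i 0) (delta_mx j 0) = A i j.
Proof. by rewrite /bilin trmx_delta -rowE -colE !mxE. Qed.

Lemma mxtrace_outer A z : \tr (z *m z^T *m A) = bilin A z z.
Proof. by rewrite -mulmxA mxtrace_mulC trace_mx11. Qed.

Lemma sqnormE x : sqnorm x = \sum_i x i 0 ^+ 2.
Proof. by rewrite /sqnorm mxE; apply: eq_bigr => i _; rewrite mxE expr2. Qed.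

Lemma sqnorm_ge0 x : 0 <= sqnorm x.
Proof. by rewrite sqnormE sumr_ge0 // => i _; exact: sqr_ge0. Qed.

Lemma coord_le_sqnorm x i : x i 0 ^+ 2 <= sqnorm x.
Proof.
by rewrite sqnormE (bigD1 i) //= lerDl sumr_ge0 // => j _; exact: sqr_ge0.
Qed.

Lemma sqnorm_gt0 x : x != 0 -> 0 < sqnorm x.
Proof.
move=> x0; rewrite lt_neqAle sqnorm_ge0 andbT eq_sym.
apply: contra_neq x0 => nx0; apply/matrixP => i j.
rewrite ord1 mxE; apply/eqP; rewrite -sqrf_eq0 eq_le sqr_ge0 andbT -nx0.
exact: coord_le_sqnorm.
Qed.

(** Each product x_i x_j is at most |x|^2 in absolute value, so the sum of the
    |A_ij| is a bound; the added 1 makes it positive, hence invertible. *)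
Lemma bilin_bounded A : exists2 C, 0 < C & forall x, bilin A x x <= C * sqnorm x.
Proof.
exists (1 + \sum_i \sum_j `|A i j|).
  by rewrite ltr_wpDr // sumr_ge0 // => i _; rewrite sumr_ge0.
move=> x; apply: (@le_trans _ _ ((\sum_i \sum_j `|A i j|) * sqnorm x)); last first.
  by rewrite ler_wpM2r ?sqnorm_ge0 // lerDr.
rewrite /bilin -mulmxA mxE mulr_suml ler_sum // => i _.
rewrite !mxE mulr_sumr mulr_suml ler_sum // => j _.
rewrite mulrCA; apply: le_trans (ler_norm _) _; rewrite normrM.
rewrite ler_wpM2l // ler_norml.
have := coord_le_sqnorm x i; have := coord_le_sqnorm x j.
have := sqr_ge0 (x i 0 + x j 0); have := sqr_ge0 (x i 0 - x j 0).
by move: (sqnorm x) => N; nra.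
Qed.

(** * Positive semidefinite matrices *)

(** The form may be degenerate, so evaluating it at the usual minimising
    combination of x and y settles only the case of a nonzero value at x or
    at y; if both values vanish, the form takes the value - 2 b^2 at
    - b x + y, where b is its value at (x, y). *)
Lemma psd_cauchy_schwarz A x y :
  psdmx A -> bilin A x y ^+ 2 <= bilin A x x * bilin A y y.
Proof.
move=> [Asym Apsd].
have quad a b : 0 <= a ^+ 2 * bilin A x x + 2 * (a * b) * bilin A x y
                     + b ^+ 2 * bilin A y y.
  have := Apsd (a *: x + b *: y).
  rewrite -/(bilin A _ _) !bilinDl !bilinDr !bilinZl !bilinZr (bilinC y x Asym).
  by congr (0 <= _); ring.
have := quad 1 0; have := quad 0 1.
have := quad (- bilin A x y) (bilin A x x).
have := quad (bilin A y y) (- bilin A x y).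
have := quad (- bilin A x y) 1.
move: (bilin A x x) (bilin A y y) (bilin A x y) => p q b h1 h2 h3 h4 h5.
have p0 : 0 <= p by nra.
have q0 : 0 <= q by nra.
have [p00|pn0] := eqVneq p 0; last first.
  have pp : 0 < p by rewrite lt_neqAle eq_sym pn0.
  have : 0 <= p * (p * q - b ^+ 2) by nra.
  by rewrite pmulr_rge0 // subr_ge0.
have [q00|qn0] := eqVneq q 0; first by nra.
have qp : 0 < q by rewrite lt_neqAle eq_sym qn0.
have : 0 <= q * (p * q - b ^+ 2) by nra.
by rewrite pmulr_rge0 // subr_ge0.
Qed.

(** One step of symmetric Gaussian elimination: nonnegativity of the Schur
    complement is Cauchy-Schwarz for x and the i-th basis vector. *)
Lemma psd_deflate A i :
  psdmx A -> A i i != 0 -> psdmx (A - (A i i)^-1 *: (col i A *m (col i A)^T)).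
Proof.
move=> Apsd; have [Asym Age0] := Apsd => Aii.
have Aii0 : 0 < A i i by rewrite lt_neqAle eq_sym Aii -bilin_delta Age0.
split.
  apply/symmetricmxP; rewrite linearB linearZ /= trmx_mul trmxK.
  by rewrite (symmetricmxP _ Asym).
move=> x; rewrite -/(bilin _ _ _) bilinB bilin_scale bilin_outer -expr2.
rewrite subr_ge0 ler_pdivrMl // colE mulmxA -/(bilin A x _).
have := psd_cauchy_schwarz x (delta_mx i 0) Apsd.
by rewrite bilin_delta [leRHS]mulrC.
Qed.

(** Induction on the number of nonzero diagonal entries of A, which
    [psd_deflate] lowers. *)
Lemma trace_psd_mul_ge0 A B : psdmx A -> psdmx B -> 0 <= \tr (A *m B).
Proof.
move=> + [_ Bge0].
have [k] := ubnP #|[set i | A i i != 0]|; elim: k A => // k IH A kA Apsd.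
case: (pickP (fun i => A i i != 0)) => [i Aii | diag0]; last first.
  (* By Cauchy-Schwarz, A_ij^2 <= A_ii A_jj = 0. *)
  suff -> : A = 0 by rewrite mul0mx mxtrace0.
  apply/matrixP => i j; rewrite mxE; apply/eqP; rewrite -sqrf_eq0.
  rewrite eq_le sqr_ge0 andbT.
  have := psd_cauchy_schwarz (delta_mx i 0) (delta_mx j 0) Apsd.
  by rewrite !bilin_delta (eqP (negbFE (diag0 i))) mul0r.
have := psd_deflate Apsd Aii.
set c := col i A; set A' := A - _ => A'psd.
have {1}-> : A = A' + (A i i)^-1 *: (c *m c^T) by rewrite subrK.
have Aii0 : 0 <= A i i by rewrite -bilin_delta; case: Apsd => _; apply.
rewrite mulmxDl linearD /= -scalemxAl linearZ /= mxtrace_outer.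
rewrite addr_ge0 ?mulr_ge0 ?invr_ge0 ?Bge0 //.
apply: IH A'psd; rewrite -ltnS; apply: leq_trans kA; rewrite ltnS.
have A'E j : A' j j = A j j - (A i i)^-1 * A j i ^+ 2.
  by rewrite !mxE big_ord1 !mxE expr2.
apply: proper_card; apply/properP; split; last first.
  by exists i; rewrite !inE // A'E expr2 mulrA mulVf // mul1r subrr eqxx.
(* A zero diagonal entry A_jj forces A_ji = 0, so it survives deflation. *)
apply/fintype.subsetP => j; rewrite !inE; apply: contra_neq => Ajj0.
have := psd_cauchy_schwarz (delta_mx j 0) (delta_mx i 0) Apsd.
rewrite !bilin_delta A'E Ajj0 mul0r => Aji.
have -> : A j i ^+ 2 = 0 by apply/eqP; rewrite eq_le Aji sqr_ge0.
by rewrite mulr0 subrr.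
Qed.

(** Put y = A^-1 x.  Cauchy-Schwarz for x and y reads
    |x|^4 <= (x^T A x) (x^T A^-1 x), and the last factor is at most C |x|^2. *)
Lemma psd_unit_coercive A :
  psdmx A -> A \in unitmx ->
  exists2 c, 0 < c & forall x, c * sqnorm x <= bilin A x x.
Proof.
move=> Apsd Aunit; have [Asym Age0] := Apsd.
have [C C0 Cb] := bilin_bounded (invmx A).
exists C^-1; first by rewrite invr_gt0.
move=> x; rewrite ler_pdivrMl //.
have [-> | /sqnorm_gt0 nx0] := eqVneq x 0.
  by rewrite /sqnorm mulmx0 mxE; apply: mulr_ge0 (ltW C0) (Age0 0).
pose y := invmx A *m x.
have Axy : bilin A x y = sqnorm x.
  by rewrite /bilin /y -mulmxA mulKVmx.
have Ayy : bilin A y y = bilin (invmx A) x x.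
  rewrite {1}/bilin -mulmxA mulKVmx // /bilin /y.
  by rewrite [LHS]trmx11E trmx_mul trmxK mulmxA.
have := psd_cauchy_schwarz x y Apsd; rewrite Axy Ayy => cs.
have := le_trans cs (ler_wpM2l (Age0 x) (Cb x)).
by rewrite expr2 mulrA ler_pM2r // [_ * C]mulrC.
Qed.

(** * Eigenvalues and the spectral norm *)

(** The vector x0 only witnesses that the dimension is positive, without which
    there are no eigenvalues. *)
Lemma eigenvalue_max_rayleigh A x0 :
  A \is symmetricmx -> x0 != 0 ->
  exists2 lam, eigenvalue A lam & forall x, bilin A x x <= lam * sqnorm x.
Proof.
move=> Asym x00.
pose S := [set bilin A x x / sqnorm x | x in [set x | x != 0]]%classic.
have [C C0 Cb] := bilin_bounded A.
have Sub : has_ubound S.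
  by exists C => _ [x /= /sqnorm_gt0 nx0 <-]; rewrite ler_pdivrMr.
have Sne : (S !=set0)%classic by exists (bilin A x0 x0 / sqnorm x0); exists x0.
have supb x : bilin A x x <= sup S * sqnorm x.
  have [-> | xn0] := eqVneq x 0.
    by rewrite /sqnorm /bilin !mulmx0 mxE mulr0.
  rewrite -ler_pdivrMr ?sqnorm_gt0 //; apply: ub_le_sup => //.
  by exists x.
exists (sup S) => //.
rewrite /eigenvalue /eigenspace kermx_eq0 row_free_unit; apply/negP => ASunit.
have Punit : (sup S)%:M - A \in unitmx.
  by rewrite -[_ - A]opprB -[- _]scaleN1r unitmxZ ?unitrN1.
have Ppsd : psdmx ((sup S)%:M - A).
  split.
    apply/symmetricmxP.
    by rewrite linearB /= tr_scalar_mx (symmetricmxP _ Asym).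
  by move=> x; rewrite -/(bilin _ _ _) bilinB bilin_scalar subr_ge0.
have [c c0 cb] := psd_unit_coercive Ppsd Punit.
suff : sup S <= sup S - c by lra.
apply: ge_sup => // _ [x /= /sqnorm_gt0 nx0 <-]; rewrite ler_pdivrMr //.
by have := cb x; rewrite bilinB bilin_scalar mulrBl; lra.
Qed.

(** Boundedness has to be known before the supremum that defines the spectral
    norm says anything about its members. *)
Lemma singular_values_ubound A : has_ubound (singular_values A).
Proof.
have [C C0 Cb] := bilin_bounded (A^T *m A).
exists (Num.sqrt C) => _ [a /= /eigenvalueP[v va v0] <-]; apply: ler_wsqrtr.
have vT0 : v^T != 0 by rewrite -(inj_eq (@trmx_inj _ _ _)) trmxK linear0.
rewrite -(ler_pM2r (sqnorm_gt0 vT0)); apply: le_trans (Cb v^T).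
by rewrite /bilin trmxK va -scalemxAl mxE /sqnorm trmxK.
Qed.

Lemma eigenvalue_le_spectral_norm A a :
  A \is symmetricmx -> eigenvalue A a -> a <= spectral_norm A.
Proof.
move=> /symmetricmxP Asym /eigenvalueP[v va v0].
apply: le_trans (ler_norm a) _; rewrite -sqrtr_sqr.
apply: ub_le_sup (singular_values_ubound A) _ _; exists (a ^+ 2) => //=.
apply/eigenvalueP; exists v => //.
by rewrite Asym mulmxA va -scalemxAl va scalerA expr2.
Qed.

(** * The two directions *)

Lemma psd_one_sub A :
  A \is symmetricmx -> spectral_norm A <= 1 -> psdmx (1%:M - A).
Proof.
move=> Asym A1; split.
  by apply/symmetricmxP; rewrite linearB /= trmx1 (symmetricmxP _ Asym).
move=> x; rewrite -/(bilin _ _ _) bilinB bilin_scalar mul1r subr_ge0.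
have [-> | xn0] := eqVneq x 0; first by rewrite /sqnorm /bilin !mulmx0 mxE.
have [lam /(eigenvalue_le_spectral_norm Asym) laml lamb] :=
  eigenvalue_max_rayleigh Asym xn0.
apply: le_trans (lamb x) _.
by rewrite ler_piMl ?sqnorm_ge0 // (le_trans laml).
Qed.

(** An eigenvalue a of the idempotent A^T A = A satisfies a^2 = a.  In dimension
    0 there is none, and the norm is the supremum of the empty set, 0. *)
Lemma spectral_norm_projection A :
  A \is symmetricmx -> A *m A = A -> spectral_norm A <= 1.
Proof.
move=> /symmetricmxP Asym AA.
have [[s Ss]|Se] := pselect (singular_values A !=set0)%classic; last first.
  suff E : singular_values A = set0%classic by rewrite /spectral_norm E sup0.
  by apply/seteqP; split => // s Ss; case: Se; exists s.
apply: ge_sup; first by exists s.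
move=> _ [a /= /eigenvalueP[v] + v0 <-]; rewrite Asym AA => va.
have : v *m A *m A = v *m A by rewrite -mulmxA AA.
rewrite va -scalemxAl va scalerA => /eqP.
rewrite -subr_eq0 -scalerBl scaler_eq0 (negbTE v0) orbF subr_eq0 => /eqP aa.
have a1 : a <= 1 by nra.
by rewrite -[leRHS]sqrtr1 ler_wsqrtr.
Qed.

(** The positivity is that of y^T P y = y^T P^T P y = |P y|^2. *)
Lemma psd_orthogonal_projection x :
  x != 0 -> let P := 1%:M - (sqnorm x)^-1 *: (x *m x^T) in
  [/\ P \is symmetricmx, P *m P = P & psdmx P].
Proof.
move=> /sqnorm_gt0 nx0 P.
have PT : P^T = P by rewrite linearB linearZ /= trmx1 trmx_mul trmxK.
have PP : P *m P = P.
  rewrite {1}/P mulmxBl mul1mx -[RHS]subr0; congr (_ - _).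
  rewrite -scalemxAl /P mulmxBr mulmx1 -scalemxAr.
  rewrite -mulmxA (mulmxA x^T) (mx11_scalar (x^T *m x)) -/(sqnorm x).
  by rewrite mul_scalar_mx -scalemxAr scalerA mulVf ?gt_eqF // scale1r subrr scaler0.
split => //; first exact/symmetricmxP.
split; first exact/symmetricmxP.
move=> y; rewrite -PP -{1}PT mulmxA -mulmxA -trmx_mul.
exact: sqnorm_ge0.
Qed.

End Bilinear.

Theorem proposition6 (R : realType) (n : nat) (X : 'M[R]_n)
    (X_sym : X \is symmetricmx) :
  psdmx X <->
  (forall Y : 'M[R]_n, psdmx Y -> spectral_norm Y <= 1 ->
     trace_inner X Y <= \tr X).
Proof.
have XT := symmetricmxP _ X_sym.
split=> [Xpsd Y [Ysym _] Y1 | H].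
  have := trace_psd_mul_ge0 Xpsd (psd_one_sub Ysym Y1).
  by rewrite mulmxBr mulmx1 linearB /= subr_ge0 /trace_inner XT.
split=> // x; rewrite -/(bilin X x x).
have [-> | xn0] := eqVneq x 0; first by rewrite /bilin mulmx0 mxE.
have [Psym PP Ppsd] := psd_orthogonal_projection xn0.
have := H _ Ppsd (spectral_norm_projection Psym PP).
rewrite /trace_inner XT mulmxBr mulmx1 linearB /= gerBl -scalemxAr linearZ /=.
by rewrite mxtrace_mulC mxtrace_outer pmulr_rge0 // invr_gt0 sqnorm_gt0.
Qed.
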